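(* Let $\{U_n\}_{n\ge 0}$ be defined by $U_0=0$, $U_1=1$, $U_{n+2}=10U_{n+1}-U_n$ for $n\ge0$. For $n\ge 1$ let $\mathcal D_2(n)$ be the smallest positive integer $m$ such that $U_0,\ldots,U_{n-1}$ are pairwise incongruent modulo $m$. For $n\ge 1$ let $e\ge 0$ be the smallest integer with $2^e\ge n$ and $f\ge 1$ the smallest integer with $3\cdot 2^f\ge n$. Then $\mathcal D_2(n)=\min\{2^e,3\cdot 2^f\}$. *)

(* Defs.v *)
From HB Require Import structures.
From mathcomp Require Import all_boot all_order all_algebra.
From mathcomp Require Import zify.
Set Implicit Arguments.
Unset Strict Implicit.
Unset Printing Implicit Defensive.
Import Order.TTheory GRing.Theory Num.Theory.
Local Open Scope ring_scope.

Fixpoint U (n : nat) : int :=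
  match n with
  | 0%N => 0
  | 1%N => 1
  | (k.+1 as k1).+1 => 10 * U k1 - U k
  end.

Lemma U_ge0_lt n : (0 <= U n) && (U n < U n.+1).
Proof.
elim: n => [|n IHn] //.
have -> : U n.+2 = 10 * U n.+1 - U n by [].
by move: (U n) (U n.+1) IHn => x y; lia.
Qed.

Lemma U_lt i j : (i < j)%N -> U i < U j.
Proof.
elim: j => // j IHj; rewrite ltnS leq_eqVlt => /predU1P[->|/IHj lt_ij].
  by case/andP: (U_ge0_lt j).
by apply: lt_trans lt_ij _; case/andP: (U_ge0_lt j).
Qed.

Definition discriminates (n m : nat) : bool :=
  (0 < m)%N &&
  [forall i : 'I_n, forall j : 'I_n, (i != j) ==> (U i != U j %[mod m])%Z].

Lemma discriminates_ex n : exists m, discriminates n m.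
Proof.
have U0 k : 0 <= U k by case/andP: (U_ge0_lt k).
exists `|U n.+1|%N; rewrite /discriminates gez0_abs //.
have -> /= : (0 < `|U n.+1|)%N by have := @U_lt 0 n.+1 isT; rewrite /=; lia.
apply/forallP => i; apply/forallP => j; apply/implyP => neq_ij.
have Umod (k : 'I_n) : (U k %% U n.+1)%Z = U k.
  by apply: modz_small; rewrite U0 U_lt // ltnW // ltnS.
rewrite !Umod; case: (ltngtP i j) => [/U_lt|/U_lt|/val_inj eq_ij].
- by move/lt_eqF => ->.
- by move/gt_eqF => ->.
- by rewrite eq_ij eqxx in neq_ij.
Qed.

Definition D2 (n : nat) : nat := ex_minn (discriminates_ex n).

Definition is_least (P : nat -> Prop) (k : nat) : Prop :=
  P k /\ forall j, P j -> (k <= j)%N.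

(* Main.v *)
(** Write [5 + 2 sqrt 6 = (sqrt 2 + sqrt 3)^2] and
    [(5 + 2 sqrt 6)^n = C n + 2 sqrt 6 * U n].  The identity
    [U (j + 2s) - U j = 2 * U s * C (j + s)], in which [C] is always prime to
    [6], shows that [2 ^ a] and [3 * 2 ^ a] ([a > 0]) separate as many terms
    as they possibly can.

    Conversely, if [m] divides [U j] with [j > 0], then [m] separates at most
    [j] terms.  For a prime [p > 4], the Frobenius sends [sqrt 2 + sqrt 3] to
    plus or minus itself or its inverse, so [p] divides [U j] for some
    [j <= (p + 1) / 2]; moreover [9] divides [U 3].  Multiplying the modulus by
    [r] multiplies this rank of appearance by at most [r].  Hence any [m] not of
    the form [2 ^ a] or [3 * 2 ^ a] separates at most [3m/5] terms, while a number
    [2 ^ a] or [3 * 2 ^ a] ([a > 0]) always lies between [n] and [5n/3].  The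
    modulus [3] itself does not separate [U 1] from [U 2]. *)

Require Import Defs.
From mathcomp Require Import all_boot all_order all_algebra.
From mathcomp Require Import all_field zify ring.
Set Implicit Arguments.
Unset Strict Implicit.
Unset Printing Implicit Defensive.
Import Order.TTheory GRing.Theory Num.Theory.
Local Open Scope ring_scope.

(** * Addition formulas and the Pell equation *)

Lemma U_recE n : U n.+2 = 10 * U n.+1 - U n.
Proof. by []. Qed.

(* [C n] is the rational part of [(5 + 2 sqrt 6)^n]. *)
Definition C (n : nat) : int := U n.+1 - 5 * U n.

Lemma US n : U n.+1 = 5 * U n + C n.
Proof. by rewrite /C; ring. Qed.

Lemma CS n : C n.+1 = 5 * C n + 24 * U n.
Proof. by rewrite /C U_recE; ring. Qed.

Lemma UC_add m n :
  U (m + n) = U m * C n + C m * U n /\ C (m + n) = C m * C n + 24 * (U m * U n).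
Proof.
elim: m => [|m [IHU IHC]]; first by rewrite add0n /C /=; split; ring.
by rewrite addSn !(US, CS) IHU IHC; split; ring.
Qed.

Lemma UD m n : U (m + n) = U m * C n + C m * U n.
Proof. by case: (UC_add m n). Qed.

Lemma CD m n : C (m + n) = C m * C n + 24 * (U m * U n).
Proof. by case: (UC_add m n). Qed.

Lemma UC_pell n : C n ^+ 2 - 24 * U n ^+ 2 = 1.
Proof.
by elim: n => [|n IHn] //; rewrite US CS -[RHS]IHn; ring.
Qed.

Lemma U_add_double j s : U (j + s.*2) = U j + 2 * (U s * C (j + s)).
Proof.
rewrite -addnn addnA UD (UD j) (CD j).
transitivity (U j * (C s ^+ 2 - 24 * U s ^+ 2) +
  2 * (U s * (C j * C s + 24 * (U j * U s)))); first by ring.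
by rewrite UC_pell mulr1.
Qed.

(** * Differences of terms modulo powers of two *)

Lemma C_odd n : ~~ (2 %| C n)%Z.
Proof.
apply/negP => /dvdzP[q Cq]; have := UC_pell n; rewrite Cq => E.
have : 2 * (2 * q ^+ 2 - 12 * U n ^+ 2) = 1 :> int by rewrite -[RHS]E; ring.
by move: (2 * q ^+ 2 - 12 * U n ^+ 2) => x; lia.
Qed.

Lemma U_parity n : exists q, U n = 2 * q + n%:Z.
Proof.
elim: n => [|n [q Uq]]; first by exists 0.
have /dvdzP[r Cr] : (2 %| C n - 1)%Z.
  by have := C_odd n; move: (C n) => c; lia.
by exists (5 * q + r + 2 * n%:Z); rewrite US Uq; lia.
Qed.

(** [U] has the parity of its index, so [i = j + 2s]. Cancelling 2 and the odd [C (j + s)] from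
    [U_add_double] leaves a power one lower dividing [U s - U 0], which is the induction hypothesis
    for the pair [s], [0]. *)
Lemma pow2_dvd_U_sub a i j : (j <= i)%N ->
  ((2 ^ a)%:Z %| U i - U j)%Z -> (2 ^ a %| i - j)%N.
Proof.
elim: a i j => [|a IHa] i j le_ji dvd; first by rewrite expn0 dvd1n.
have [s Es] : exists s, i = (j + s.*2)%N.
  exists (i - j)./2; rewrite even_halfK ?subnKC //.
  have [q Uq] := U_parity i; have [r Ur] := U_parity j.
  case/dvdzP: dvd => t; rewrite Uq Ur expnS PoszM; move: ((2 ^ a)%:Z) => P E.
  have {}E : 2 * (t * P - q + r) = i%:Z - j%:Z.
    rewrite mulrDr mulrBr mulrCA -E; ring.
  by move: (t * P - q + r) E => z; lia.
move: dvd; rewrite {}Es in le_ji *; rewrite U_add_double addrAC subrr add0r addKn.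
rewrite expnS PoszM dvdz_mul2l // Gauss_dvdzl; last first.
  rewrite coprimezE /= coprimeXl // prime_coprime //.
  exact: C_odd.
rewrite -muln2 mulnC dvdn_pmul2r // => dvd.
by rewrite -[s]subn0; apply: IHa; rewrite ?subr0.
Qed.

(** * Divisibility at multiples of an index *)

(** Binomial expansion of the power [k.+1] of [C j + 2 sqrt 6 * U j], to first order in [U j]. *)
Lemma UM j k : exists v w,
  U (k.+1 * j) = U j * (k.+1%:Z * C j ^+ k + U j * w) /\
  C (k.+1 * j) = C j ^+ k.+1 + U j * v.
Proof.
elim: k => [|k [v [w [EU EC]]]].
  by exists 0, 0; rewrite mul1n expr0 expr1; split; ring.
rewrite mulSn UD CD EU EC.
exists (C j * v + 24 * U j * (k.+1%:Z * C j ^+ k + U j * w)).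
exists (w * C j + v).
have -> : k.+2%:Z = k.+1%:Z + 1 by lia.
by rewrite !exprS; split; ring.
Qed.

Lemma dvdz_UM d j k : (d %| U j)%Z -> (d %| U (k * j))%Z.
Proof.
case: k => [|k] dvd; first by rewrite dvdz0.
have [v [w [-> _]]] := UM j k.
exact: dvdz_mulr.
Qed.

(** In the second factor given by [UM], [p] divides both summands: the multiplier [p] itself and,
    through [m], the term in [U j]. *)
Lemma dvdz_UM_mul (m p j : nat) : (p %| m)%N -> (m%:Z %| U j)%Z ->
  ((p * m)%:Z %| U (p * j))%Z.
Proof.
case: p => [|p] dvd_pm dvd_mU; first by rewrite !mul0n dvdz0.
have [v [w [-> _]]] := UM j p.
rewrite mulnC PoszM dvdz_mul // rpredD // dvdz_mulr //.
by apply: dvdz_trans dvd_mU.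
Qed.

(** * Rank of appearance of a prime, by Frobenius *)

Lemma prime_char_closure (p : nat) : prime p ->
  exists K : closedFieldType, p \in [pchar K].
Proof.
move=> p_pr; have [K [f _]] := countable_algebraic_closure 'F_p.
by exists K; apply: (rmorph_pchar f); apply: pchar_Fp.
Qed.

Lemma closed_sqrt (K : closedFieldType) (c : K) : exists x, x ^+ 2 = c.
Proof.
have [x Ex] := solve_monicpoly (nth 0 [:: c]) (isT : (0 < 2)%N).
by exists x; rewrite Ex !big_ord_recl big_ord0 /= mulr1 mul0r !addr0.
Qed.

(** Here [a * b] plays the role of [sqrt 6]. Either root may be taken for [a], so the formula also
    covers [b - a]. *)
Lemma sqrt2D3_expr_double (K : comNzRingType) (a b : K) n : a ^+ 2 = 2 -> b ^+ 2 = 3 ->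
  (b + a) ^+ n.*2 = (C n)%:~R + 2 * a * b * (U n)%:~R.
Proof.
move=> a2 b2; elim: n => [|n IHn]; first by rewrite /C /= expr0; ring.
have sq : (b + a) ^+ 2 = 5 + 2 * a * b by rewrite sqrrD a2 b2; ring.
have ab : a * b * a * b = 6.
  by rewrite [a * b * a]mulrAC -expr2 -mulrA -expr2 a2 b2; ring.
rewrite doubleS 2!exprS IHn US CS mulrA -expr2 sq.
by move: (C n) (U n) => c u; ring: ab.
Qed.

Lemma prime_rank (p : nat) : prime p -> (4 < p)%N ->
  exists j, [/\ (0 < j)%N, (j.*2 <= p.+1)%N & (p%:Z %| U j)%Z].
Proof.
move=> p_pr p_gt4; have [K charK] := prime_char_closure p_pr.
have [a a2] := closed_sqrt (2 : K); have [b b2] := closed_sqrt (3 : K).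
have ndvd k : (0 < k)%N -> (k < p)%N -> k%:R != 0 :> K.
  by move=> k0 kp; rewrite -(dvdn_pcharf charK) gtnNdvd.
have a0 : a != 0.
  by apply: contraNneq (ndvd 2%N isT (ltnW (ltnW p_gt4))) => a0; rewrite -a2 a0 expr0n.
have b0 : b != 0.
  by apply: contraNneq (ndvd 3%N isT (ltnW p_gt4)) => b0; rewrite -b2 b0 expr0n.
have frob_sqrt (x : K) (k : nat) : x ^+ 2 = k%:R -> (x ^+ p == x) || (x ^+ p == - x).
  move=> xk; rewrite -eqf_sqr exprAC xk -(pFrobenius_autE charK).
  by rewrite pFrobenius_aut_nat.
have inv : (b + a) * (b - a) = 1 by rewrite mulrC -subr_sqr a2 b2; ring.
(* If an even power of [b + a] is a sign, its inverse [b - a] has the same power; subtracting the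
   two expansions leaves [4 * a * b * U n = 0]. *)
have dvdU n (e : bool) : (b + a) ^+ n.*2 = (-1) ^+ e -> (p%:Z %| U n)%Z.
  move=> En.
  have En' : (b - a) ^+ n.*2 = (-1) ^+ e.
    have := congr1 (fun z => z ^+ n.*2) inv.
    rewrite exprMn En expr1n => /(congr1 ( *%R ((-1) ^+ e))).
    by rewrite signrMK mulr1.
  have a2' : (- a) ^+ 2 = 2 by rewrite sqrrN.
  move: En En'; rewrite (sqrt2D3_expr_double n a2 b2) (sqrt2D3_expr_double n a2' b2) => <- E.
  rewrite (dvdz_pcharf charK).
  have /eqP : 4 * a * b * (U n)%:~R = 0.
    transitivity ((C n)%:~R + 2 * a * b * (U n)%:~R
                  - ((C n)%:~R + 2 * - a * b * (U n)%:~R)).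
      by move: (C n) (U n) => c u; ring.
    by rewrite E subrr.
  by rewrite !mulf_eq0 (negPf a0) (negPf b0) (negPf (ndvd 4%N isT p_gt4)) !orbF.
have p_odd : odd p by case: (even_prime p_pr) p_gt4 => [->|].
have Ep : p = p./2.*2.+1 by rewrite -[LHS]odd_double_half p_odd.
have frob : (b + a) ^+ p = b ^+ p + a ^+ p.
  by rewrite -!(pFrobenius_autE charK) pFrobenius_autD_comm //; exact: mulrC.
have same (e : bool) : (b + a) ^+ p = (-1) ^+ e * (b + a) ->
    (b + a) ^+ p./2.*2 = (-1) ^+ e.
  rewrite [in LHS]Ep exprSr => /(congr1 (fun z => z * (b - a))).
  by rewrite -!mulrA inv !mulr1.
have opp (e : bool) : (b + a) ^+ p = (-1) ^+ e * (b - a) ->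
    (b + a) ^+ p./2.+1.*2 = (-1) ^+ e.
  by rewrite doubleS -Ep exprSr => ->; rewrite -mulrA [_ * (b + a)]mulrC inv mulr1.
have h0 : (0 < p./2)%N by lia.
have hl : (p./2.*2 <= p.+1)%N by lia.
have hl' : (p./2.+1.*2 <= p.+1)%N by lia.
(* Frobenius acting on [a] and [b] by equal signs gives the index [p./2], by opposite signs
   [p./2.+1]. *)
case/orP: (frob_sqrt a 2%N a2) => /eqP Ea; case/orP: (frob_sqrt b 3%N b2) => /eqP Eb;
  rewrite {}Ea {}Eb in frob.
- by exists p./2; split=> //; apply: (dvdU _ false); apply: same; rewrite frob mul1r.
- exists p./2.+1; split=> //; apply: (dvdU _ true); apply: opp; rewrite frob.
  by rewrite mulN1r opprB addrC.
- by exists p./2.+1; split=> //; apply: (dvdU _ false); apply: opp; rewrite frob mul1r.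
- exists p./2; split=> //; apply: (dvdU _ true); apply: same; rewrite frob.
  by rewrite mulN1r opprD.
Qed.

(** * Ranks of composite moduli *)

Lemma prime_rank_le (p : nat) : prime p ->
  exists j, [/\ (0 < j)%N, (j <= p)%N & (p%:Z %| U j)%Z].
Proof.
move=> p_pr; have := prime_gt1 p_pr.
case: (ltnP 4 p) => [p_gt4 _|]; last first.
  (* [U 2 = 10] and [U 3 = 99]. *)
  by case: p p_pr => [|[|[|[|[|]]]]] // _ _ _; [exists 2%N | exists 3%N].
by have [j [j0 jp dvd]] := prime_rank p_pr p_gt4; exists j; split=> //; lia.
Qed.

(** Strip the least prime [p] of [r = p * q]. If [p] divides [q * m], multiply the index by [p];
    otherwise the moduli are coprime, and multiplying by an index at most [p] with [p] dividing its
    term suffices. *)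
Lemma rank_mul (r m j : nat) : (0 < r)%N -> (0 < j)%N -> (m%:Z %| U j)%Z ->
  exists k, [/\ (0 < k)%N, (k <= r * j)%N & ((r * m)%:Z %| U k)%Z].
Proof.
move=> r0 j0 dvd; elim/ltn_ind: r r0 => r IHr r0.
case: (leqP r 1) => [r1|r1]; first by have -> : r = 1%N; [lia | exists j; rewrite !mul1n].
have p_pr := pdiv_prime r1; set p := pdiv r in p_pr.
have [q Er] : exists q, r = (p * q)%N.
  by exists (r %/ p)%N; rewrite mulnC divnK // pdiv_dvd.
have p_gt1 := prime_gt1 p_pr.
have [||k [k0 kj dvdk]] := IHr q; [by nia | by nia |].
have [p_dvd|p_ndvd] := boolP (p %| q * m)%N.
  exists (p * k)%N; split; [by nia | by nia |].
  by rewrite Er -mulnA; apply: dvdz_UM_mul.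
have [z [z0 zp dvdz]] := prime_rank_le p_pr.
exists (z * k)%N; split; [by nia | by nia |].
rewrite Er -mulnA PoszM Gauss_dvdz; last by rewrite coprimezE /= prime_coprime.
by rewrite [(z * k)%N]mulnC dvdz_UM // mulnC dvdz_UM.
Qed.

Lemma rank_le (m : nat) : (0 < m)%N ->
  exists j, [/\ (0 < j)%N, (j <= m)%N & (m%:Z %| U j)%Z].
Proof.
move=> m0; have [k] := @rank_mul m 1 1 m0 isT isT.
by rewrite !muln1; exists k.
Qed.

Lemma small_rank_or_pow2_3pow2 (m : nat) : (0 < m)%N ->
  (exists j, [/\ (0 < j)%N, (5 * j <= 3 * m)%N & (m%:Z %| U j)%Z]) \/
  exists a, m = (2 ^ a)%N \/ m = (3 * 2 ^ a)%N.
Proof.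
move=> m0.
have [/hasP[p]|no_big] := boolP (has (fun p => 4 < p)%N (primes m)).
  rewrite mem_primes => /and3P[p_pr _ /dvdnP[r Er]] p_gt4; left.
  have [j [j0 jp dvd]] := prime_rank p_pr p_gt4.
  have [|k [k0 kj dvdk]] := @rank_mul r p j _ j0 dvd; first by nia.
  exists k; split=> //; last by rewrite Er.
  (* [5 * (p + 1) <= 6 * p] holds since [p >= 5]; the prime 5 is where the ratio 3/5 comes from. *)
  have : (r * (5 * j.*2) <= r * (6 * p))%N by rewrite leq_mul2l; apply/orP; lia.
  by lia.
have [/dvdnP[r Er]|ndvd9] := boolP (9 %| m)%N.
  left; have [||k [k0 kj dvdk]] := @rank_mul r 9 3 _ isT _; [by lia | by [] |].
  by exists k; split=> //; [lia | rewrite Er].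
(* Only the primes 2 and 3 remain, and 9 does not divide [m], so the odd part [r] is 1 or 3. *)
right; have [r co2r Em] := pfactor_coprime (isT : prime 2) m0.
exists (logn 2 m).
have pr3 p : prime p -> (p %| r)%N -> p = 3%N.
  move=> p_pr p_dvd; have p_gt1 := prime_gt1 p_pr.
  have : p \in primes m by rewrite mem_primes p_pr m0 Em dvdn_mulr.
  move/(hasPn no_big); case: p p_pr p_dvd p_gt1 => [|[|[|[|[|p]]]]] // _ p_dvd _ _.
  by move: co2r; rewrite prime_coprime // p_dvd.
have [r1|r_gt1] := leqP r 1; [left | right].
  by rewrite {1}Em (_ : r = 1%N) ?mul1n //; case: r r1 Em {co2r pr3} m0 => [|[]]//; lia.
have /dvdnP[s Es] : (3 %| r)%N by rewrite -(pr3 _ (pdiv_prime r_gt1)) ?pdiv_dvd.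
have [s1|s_gt1] := leqP s 1; first by rewrite {1}Em; congr (_ * _)%N; lia.
have : (3 %| s)%N.
  by rewrite -(pr3 _ (pdiv_prime s_gt1)) ?pdiv_dvd // Es dvdn_mulr ?pdiv_dvd.
case/dvdnP=> t Et; case/negP: ndvd9; rewrite Em Es Et.
by rewrite -(mulnA t) dvdn_mulr // dvdn_mull.
Qed.

(** * Discriminating moduli *)

(** Otherwise [U j] and [U 0 = 0] would be two congruent terms. *)
Lemma discriminates_le n m j : discriminates n m -> (0 < j)%N ->
  (m%:Z %| U j)%Z -> (n <= j)%N.
Proof.
case/andP=> m0 /forallP disc j0 dvd; rewrite leqNgt; apply/negP => jn.
have /forallP/(_ (Ordinal (ltn_trans j0 jn)))/implyP := disc (Ordinal jn).
have -> : Ordinal jn != Ordinal (ltn_trans j0 jn) by rewrite -val_eqE /= -lt0n.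
by rewrite eqz_mod_dvd subr0 dvd => /(_ isT).
Qed.

Lemma discriminatesI n m : (0 < m)%N ->
  (forall i j, (j < i)%N -> (i < n)%N -> (m%:Z %| U i - U j)%Z -> False) ->
  discriminates n m.
Proof.
move=> m0 inj; rewrite /discriminates m0 /=.
apply/forallP => i; apply/forallP => j; apply/implyP.
rewrite -val_eqE neq_ltn => /orP[] lt; apply/negP.
  by rewrite eq_sym eqz_mod_dvd; apply: inj lt (ltn_ord j).
by rewrite eqz_mod_dvd; apply: inj lt (ltn_ord i).
Qed.

Lemma discriminates_pow2 n a : (n <= 2 ^ a)%N -> discriminates n (2 ^ a).
Proof.
move=> na; apply: discriminatesI => [|i j ji iN dvd]; first by rewrite expn_gt0.
have := pow2_dvd_U_sub (ltnW ji) dvd.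
by rewrite gtnNdvd //; lia.
Qed.

Lemma U_mod3 n : exists q, U n.+3 = 3 * q - U n.
Proof.
by exists (33 * U n.+1 - 3 * U n); rewrite !U_recE; ring.
Qed.

Lemma dvd3_U n : (3 %| U n)%Z -> (3 %| n)%N.
Proof.
elim/ltn_ind: n => -[|[|[|n]]] // IHn dvd.
have [q Eq] := U_mod3 n.
rewrite -[n.+3]addn3 dvdn_addl //; apply: IHn; first by lia.
have -> : U n = 3 * q - U n.+3 by rewrite Eq; ring.
by rewrite rpredB // dvdz_mulr.
Qed.

Lemma C_coprime3 n : coprimez 3 (C n).
Proof.
(* Bezout coefficients read off the Pell equation. *)
apply/coprimezP; exists (- 8 * U n ^+ 2, C n) => /=.
by rewrite -[RHS](UC_pell n); ring.
Qed.

(** The condition [0 < a] makes [i - j] even, so [U_add_double] applies modulo 3 as well. *)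
Lemma dvd_3pow2_U_sub a i j : (0 < a)%N -> (j <= i)%N ->
  ((3 * 2 ^ a)%:Z %| U i - U j)%Z -> (3 * 2 ^ a %| i - j)%N.
Proof.
move=> a0 le_ji; have co : coprime 3 (2 ^ a) by rewrite coprimeXr.
rewrite PoszM Gauss_dvdz // Gauss_dvd // => /andP[dvd3 /(pow2_dvd_U_sub le_ji) dvd2].
rewrite dvd2 andbT.
have /dvdnP[s Es] : (2 %| i - j)%N by apply: dvdn_trans dvd2; rewrite dvdn_exp.
have Ei : i = (j + s.*2)%N by lia.
move: dvd3; rewrite Ei U_add_double addrAC subrr add0r Gauss_dvdzr //.
rewrite Gauss_dvdzl ?C_coprime3 // => /dvd3_U dvd.
by rewrite addKn -muln2 dvdn_mulr.
Qed.

Lemma discriminates_3pow2 n a : (0 < a)%N -> (n <= 3 * 2 ^ a)%N ->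
  discriminates n (3 * 2 ^ a).
Proof.
move=> a0 na; apply: discriminatesI => [|i j ji iN dvd].
  by rewrite muln_gt0 expn_gt0.
have := dvd_3pow2_U_sub a0 (ltnW ji) dvd.
by rewrite gtnNdvd //; lia.
Qed.

Lemma discriminates_3 n : discriminates n 3 -> (n <= 2)%N.
Proof.
case/andP=> _ /forallP disc; rewrite leqNgt; apply/negP => n2.
have /forallP/(_ (Ordinal (ltnW n2)))/implyP := disc (Ordinal n2).
by move/(_ isT).
Qed.

(** * The least discriminating modulus *)

Theorem theorem2 (n e f : nat) (hn : (1 <= n)%N)
  (he : is_least (fun k : nat => (n <= 2 ^ k)%N) e)
  (hf : is_least (fun k : nat => (1 <= k)%N /\ (n <= 3 * 2 ^ k)%N) f) :
  D2 n = minn (2 ^ e) (3 * 2 ^ f).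
Proof.
have [ne min_e] := he; have [[f0 nf] min_f] := hf.
rewrite /D2; case: ex_minnP => m disc min_m; apply/eqP; rewrite eqn_leq.
(* Both candidates discriminate, so it remains to bound one of them by [m]. *)
rewrite leq_min !min_m ?discriminates_pow2 ?discriminates_3pow2 //= geq_min.
have m0 : (0 < m)%N by case/andP: disc.
have [j [j0 jm dvdj]] := rank_le m0.
have nm : (n <= m)%N := leq_trans (discriminates_le disc j0 dvdj) jm.
case: (small_rank_or_pow2_3pow2 m0) => [[k [k0 km dvdk]]|[a [Em|Em]]].
- have nk := discriminates_le disc k0 dvdk.
  have n53 : (5 * n <= 3 * m)%N by lia.
  case: e {he} ne min_e => [|[|[|e]]] ne min_e; first by rewrite m0.
  + by have := min_e 0%N; rewrite /= expn1; case: (leqP n 1) => [n1 /(_ isT)|]; lia.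
  + have := min_e 1%N; case: (leqP n (2 ^ 1)) => [n1 /(_ isT)|]; lia.
  (* The exponent is now [e.+3]. If [n <= 3 * 2 ^ e.+1], then [3 * 2 ^ f < 3n/2]; otherwise
     [2 ^ e.+3 < 4n/3]. Both bounds are below [5n/3 <= m]. *)
  + have [le_n|gt_n] := leqP n (3 * 2 ^ e.+1).
      have fe := min_f e.+1 (conj isT le_n).
      have gt_n : (2 ^ e.+2 < n)%N.
        by rewrite ltnNge; apply/negP => /min_e; rewrite ltnn.
      have : (2 ^ f <= 2 ^ e.+1)%N by rewrite leq_exp2l.
      by move: gt_n; rewrite [(2 ^ e.+2)%N]expnS; lia.
    by move: gt_n; rewrite [(2 ^ e.+3)%N]expnS [(2 ^ e.+2)%N]expnS; lia.
- by rewrite Em leq_exp2l // min_e // -Em.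
- case: a Em => [|a] Em; last first.
    by rewrite [in X in _ || X]Em leq_pmul2l // leq_exp2l // min_f ?orbT // -Em.
  (* For [m = 3] this forces an exponent at most 1, hence a power of two at most 2. *)
  have n2 : (n <= 2)%N by apply: discriminates_3; rewrite Em in disc.
  by have := min_e 1%N n2; rewrite Em; case: e {he ne min_e} => [|[]].
Qed.
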